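(* Let $X$ be an $\epsilon$-simplicial set which has the extension property with respect to all $\epsilon$-horns, i.e. with respect to $\Lambda^n_{\epsilon,0}\subset\Delta_\epsilon^n$ and $\Lambda^n_{\epsilon,n}\subset\Delta_\epsilon^n$ for all $n\ge1$. If $X$ has the extension property with respect to $$\partial_1\Delta_\epsilon^4\cup\partial_3\Delta_\epsilon^4\hookrightarrow\Delta_\epsilon^4,$$ then the relations $\mu\colon X_1\times X_1\dashrightarrow X_1$ and $\delta\colon X_1\dashrightarrow X_1\times X_1$ associated with $X$ satisfy the Frobenius identity $$(\mu\times\mathrm{id})\circ(\mathrm{id}\times\delta)=\delta\circ\mu=(\mathrm{id}\times\mu)\circ(\delta\times\mathrm{id})$$ as relations $X_1\times X_1\dashrightarrow X_1\times X_1$.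
   Context: A relation from $A$ to $B$ is written $R\colon A\dashrightarrow B$, and $R\colon a\dashrightarrow b$ means $a$ is $R$-related to $b$; composition and products are those of the monoidal category of sets and relations. $\Delta$ is the category of finite chains $[n]=\{0<\dots<n\}$ and non-decreasing maps. $\Delta_\epsilon$ is the category obtained from $\Delta$ by freely adding one object $[\epsilon]$, one arrow $w\colon[1]\to[\epsilon]$, and the induced compositions. An $\epsilon$-simplicial set is a presheaf of sets on $\Delta_\epsilon$; equivalently, a simplicial set $X$ together with a set $X_\epsilon$ and a map $X_\epsilon\to X_1$. Edges in the image of $X_\epsilon\to X_1$ are called $\epsilon$-edges. For $n\ge1$, $\Delta_\epsilon^n$ is the $\epsilon$-simplicial set with underlying simplicial set the standard simplex $\Delta^n$ and $(\Delta_\epsilon^n)_\epsilon$ a one-element set mapped to the edge from $0$ to $n$. $\partial_i\Delta_\epsilon^n\subset\Delta_\epsilon^n$ is the codimension-one face opposite the vertex $i$, where the marked edge remains marked if it belongs to the face. $\Lambda^n_{\epsilon,i}=\bigcup_{j\neq i}\partial_j\Delta_\epsilon^n$. $X$ has the extension property with respect to $m\colon A\to B$ if every morphism $A\to X$ of $\epsilon$-simplicial sets factors through $m$. For a simplex of $X$, the edge $ij$ is its restriction along $\langle i,j\rangle$. The relations associated with an $\epsilon$-simplicial set $X$ are defined for $a,b,c\in X_1$ as follows. - $\mu\colon(b,a)\dashrightarrow c$ iff there is a $2$-simplex of $X$ with edge $01$ equal to $a$, edge $12$ equal to $b$, and edge $02$ equal to $c$. - $\delta\colon c\dashrightarrow(a,b)$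 iff there is a $3$-simplex of $X$ with edge $02$ equal to $a$, edge $13$ equal to $b$, edge $12$ equal to $c$, and edge $03$ an $\epsilon$-edge. *)

(* Defs.v *)
From HB Require Import structures.
From mathcomp Require Import all_boot.
Set Implicit Arguments.
Unset Strict Implicit.
Unset Printing Implicit Defensive.

(* [monotone m n] is the set of arrows [m] -> [n] of Delta, where [n] is
   represented by 'I_n.+1. *)
Record monotone (m n : nat) := Monotone {
  mono_fun :> {ffun 'I_m.+1 -> 'I_n.+1};
  mono_funP : [forall i : 'I_m.+1, forall j : 'I_m.+1,
                 (i <= j) ==> (mono_fun i <= mono_fun j)] }.

HB.instance Definition _ m n := [isSub for @mono_fun m n].

Lemma mono_leq m n (f : monotone m n) (i j : 'I_m.+1) : i <= j -> f i <= f j.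
Proof. by move: (mono_funP f) => /forallP/(_ i)/forallP/(_ j)/implyP. Qed.

Lemma monoP m n (f g : monotone m n) : (forall i, f i = g i) -> f = g.
Proof. by move=> efg; apply: val_inj; apply/ffunP. Qed.

Fact mono_id_subproof n :
  [forall i : 'I_n.+1, forall j : 'I_n.+1,
     (i <= j) ==> ([ffun k : 'I_n.+1 => k] i <= [ffun k : 'I_n.+1 => k] j)].
Proof. by apply/'forall_forallP => i j; apply/implyP; rewrite !ffunE. Qed.

Definition mono_id n : monotone n n := Monotone (mono_id_subproof n).

Fact mono_comp_subproof l m n (g : monotone m n) (f : monotone l m) :
  [forall i : 'I_l.+1, forall j : 'I_l.+1,
     (i <= j) ==> ([ffun k => g (f k)] i <= [ffun k => g (f k)] j)].
Proof.
apply/'forall_forallP => i j; apply/implyP => le_ij.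
by rewrite !ffunE; do 2!apply: mono_leq.
Qed.

Definition mono_comp l m n (g : monotone m n) (f : monotone l m) :
  monotone l n := Monotone (mono_comp_subproof g f).

Lemma mono_idE n i : mono_id n i = i.
Proof. by rewrite ffunE. Qed.

Lemma mono_compE l m n (g : monotone m n) (f : monotone l m) i :
  mono_comp g f i = g (f i).
Proof. by rewrite ffunE. Qed.

Lemma mono_comp1f m n (f : monotone m n) : mono_comp (mono_id n) f = f.
Proof. by apply: monoP => i; rewrite mono_compE mono_idE. Qed.

Lemma mono_compf1 m n (f : monotone m n) : mono_comp f (mono_id m) = f.
Proof. by apply: monoP => i; rewrite mono_compE mono_idE. Qed.

Lemma mono_compA k l m n (h : monotone m n) (g : monotone l m)
    (f : monotone k l) :
  mono_comp h (mono_comp g f) = mono_comp (mono_comp h g) f.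
Proof. by apply: monoP => i; rewrite !mono_compE. Qed.

Fact edge_map_subproof n i j (le_ij : i <= j) (le_jn : j <= n) :
  let e : {ffun 'I_2 -> 'I_n.+1} :=
    [ffun k => if k == ord0 then Ordinal (leq_trans le_ij le_jn : i < n.+1)
               else Ordinal (le_jn : j < n.+1)] in
  [forall k : 'I_2, forall l : 'I_2, (k <= l) ==> (e k <= e l)].
Proof.
apply/'forall_forallP => k l; apply/implyP; rewrite !ffunE.
case: (k =P ord0) => [_|/eqP k0]; case: (l =P ord0) => [->|_] //=.
by rewrite leqn0 => k_eq0; rewrite -val_eqE /= k_eq0 in k0.
Qed.

(* <i, j> : [1] -> [n] *)
Definition edge_map n i j (le_ij : i <= j) (le_jn : j <= n) : monotone 1 n :=
  Monotone (edge_map_subproof le_ij le_jn).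

(* A presheaf of sets on Delta_epsilon: since [epsilon] and
   w : [1] -> [epsilon] are added freely, this is a simplicial set together
   with a set [eps] and a map [eps_edge] (the action of w), subject to no
   further equation. *)
Record eps_sset := EpsSSet {
  simp : nat -> Type;
  act : forall m n, monotone m n -> simp n -> simp m;
  eps : Type;
  eps_edge : eps -> simp 1;
  act_id : forall n (x : simp n), act (mono_id n) x = x;
  act_comp : forall l m n (g : monotone m n) (f : monotone l m) (x : simp n),
    act (mono_comp g f) x = act f (act g x) }.

Record eps_hom (A B : eps_sset) := EpsHom {
  hom_simp : forall n, simp A n -> simp B n;
  hom_eps : eps A -> eps B;
  hom_act : forall m n (f : monotone m n) (x : simp A n),
    hom_simp (act f x) = act f (hom_simp x);
  hom_eps_edge : forall e : eps A,
    hom_simp (eps_edge e) = eps_edge (hom_eps e) }.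

Definition extension_property (X A B : eps_sset) (m : eps_hom A B) : Prop :=
  forall f : eps_hom A X, exists g : eps_hom B X,
    (forall n (x : simp A n), hom_simp g (hom_simp m x) = hom_simp f x) /\
    (forall e : eps A, hom_eps g (hom_eps m e) = hom_eps f e).

(* Subobjects are given by boolean predicates, so that equality of elements
   of a subobject is equality in the ambient object. *)
Record eps_sub (X : eps_sset) := EpsSub {
  sub_simp : forall n, pred (simp X n);
  sub_eps : pred (eps X);
  sub_act : forall m n (f : monotone m n) (x : simp X n),
    sub_simp x -> sub_simp (act f x);
  sub_eps_edge : forall e : eps X, sub_eps e -> sub_simp (eps_edge e) }.

Section SubObject.
Variables (X : eps_sset) (S : eps_sub X).

Definition sub_obj_act m n (f : monotone m n) (x : {x | sub_simp S (n:=n) x}) :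
  {x | sub_simp S (n:=m) x} :=
  exist _ (act f (sval x)) (sub_act f (svalP x)).

Definition sub_obj_eps_edge (e : {e | sub_eps S e}) :
  {x | sub_simp S (n:=1) x} :=
  exist _ (eps_edge (sval e)) (sub_eps_edge (svalP e)).

Fact sub_obj_act_id n (x : {x | sub_simp S (n:=n) x}) :
  sub_obj_act (mono_id n) x = x.
Proof. by apply: val_inj; rewrite /= act_id. Qed.

Fact sub_obj_act_comp l m n (g : monotone m n) (f : monotone l m)
    (x : {x | sub_simp S (n:=n) x}) :
  sub_obj_act (mono_comp g f) x = sub_obj_act f (sub_obj_act g x).
Proof. by apply: val_inj; rewrite /= act_comp. Qed.

Definition sub_obj : eps_sset :=
  EpsSSet sub_obj_eps_edge sub_obj_act_id sub_obj_act_comp.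

Definition incl : eps_hom sub_obj X :=
  @EpsHom sub_obj X (fun n x => sval x) (fun e => sval e)
    (fun _ _ _ _ => erefl) (fun _ => erefl).

End SubObject.

Section Unions.
Variable X : eps_sset.

Section Binary.
Variables S T : eps_sub X.

Fact subU_act m n (f : monotone m n) (x : simp X n) :
  sub_simp S x || sub_simp T x -> sub_simp S (act f x) || sub_simp T (act f x).
Proof. by case/orP => /sub_act ->; rewrite ?orbT. Qed.

Fact subU_eps_edge (e : eps X) :
  sub_eps S e || sub_eps T e ->
  sub_simp S (eps_edge e) || sub_simp T (eps_edge e).
Proof. by case/orP => /sub_eps_edge ->; rewrite ?orbT. Qed.

Definition subU : eps_sub X := EpsSub subU_act subU_eps_edge.

End Binary.

Section Indexed.
Variables (I : finType) (P : pred I) (S : I -> eps_sub X).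

Fact sub_bigU_act m n (f : monotone m n) (x : simp X n) :
  [exists (i | P i), sub_simp (S i) x] ->
  [exists (i | P i), sub_simp (S i) (act f x)].
Proof.
by case/exists_inP => i Pi Six; apply/exists_inP; exists i => //; apply: sub_act.
Qed.

Fact sub_bigU_eps_edge (e : eps X) :
  [exists (i | P i), sub_eps (S i) e] ->
  [exists (i | P i), sub_simp (S i) (eps_edge e)].
Proof.
case/exists_inP => i Pi Sie; apply/exists_inP; exists i => //.
exact: sub_eps_edge.
Qed.

Definition sub_bigU : eps_sub X := EpsSub sub_bigU_act sub_bigU_eps_edge.

End Indexed.
End Unions.

(* Delta_epsilon^n, meaningful for n >= 1 (at n = 0 the marked edge would be
   degenerate). *)
Definition simplex (n : nat) : eps_sset :=
  @EpsSSet (fun m => monotone m n) (fun l m f x => mono_comp x f)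
    unit (fun _ => edge_map (leq0n n) (leqnn n))
    (fun m x => mono_compf1 x) (fun k l m g f x => mono_compA x g f).

Section Face.
Variables (n : nat) (i : 'I_n.+1).

Definition in_face m (x : simp (simplex n) m) : bool :=
  [forall k : 'I_m.+1, x k != i].

Fact face_act l m (f : monotone l m) (x : simp (simplex n) m) :
  in_face x -> in_face (act f x).
Proof. by move/forallP => xi; apply/forallP => k; rewrite mono_compE. Qed.

Definition face : eps_sub (simplex n) :=
  @EpsSub (simplex n) in_face (fun e => in_face (eps_edge e)) face_act
    (fun _ h => h).

End Face.

Definition horn n (i : 'I_n.+1) : eps_sub (simplex n) :=
  sub_bigU (fun j => j != i) (@face n).

Definition relation (A B : Type) := A -> B -> Prop.

Definition rel_id A : relation A A := fun a b => a = b.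

Definition rel_comp A B C (S : relation B C) (R : relation A B) :
  relation A C := fun a c => exists b, R a b /\ S b c.

Definition rel_prod A B C D (R : relation A B) (S : relation C D) :
  relation (A * C) (B * D) := fun p q => R p.1 q.1 /\ S p.2 q.2.

(* The associativity constraint of the cartesian product of sets, as a
   relation, and its inverse. *)
Definition rel_assoc A B C : relation (A * (B * C)) (A * B * C) :=
  fun p q => q = (p.1, p.2.1, p.2.2).

Definition rel_assocV A B C : relation (A * B * C) (A * (B * C)) :=
  fun p q => q = (p.1.1, (p.1.2, p.2)).

Arguments rel_id {A}.
Arguments rel_assoc {A B C}.
Arguments rel_assocV {A B C}.

Notation "S \circ R" := (rel_comp S R) (at level 50, left associativity).
Notation "R \times S" := (rel_prod R S) (at level 40, left associativity).

Definition edge (X : eps_sset) n (s : simp X n) i j (le_ij : i <= j)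
  (le_jn : j <= n) : simp X 1 := act (edge_map le_ij le_jn) s.

(* For numerals i <= j <= dimension of s. *)
Notation "s '@edge' i j" := (@edge _ _ s i j isT isT)
  (at level 10, i at level 8, j at level 8, no associativity).

Definition is_eps_edge (X : eps_sset) (a : simp X 1) : Prop :=
  exists e : eps X, eps_edge e = a.

(* The first component of the argument is the edge 12. *)
Definition mu (X : eps_sset) : relation (simp X 1 * simp X 1) (simp X 1) :=
  fun ba c => exists s : simp X 2,
    [/\ s @edge 0 1 = ba.2, s @edge 1 2 = ba.1 & s @edge 0 2 = c].

Definition delta (X : eps_sset) : relation (simp X 1) (simp X 1 * simp X 1) :=
  fun c ab => exists s : simp X 3,
    [/\ s @edge 0 2 = ab.1, s @edge 1 3 = ab.2, s @edge 1 2 = c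
      & is_eps_edge (s @edge 0 3)].

Arguments mu X : clear implicits.
Arguments delta X : clear implicits.

(* Main.v *)
(* All three composites relate (b, a) to (p, q) exactly when there is a 4-simplex
   with edges 12 = a, 23 = b, 03 = p, 14 = q and 04 an epsilon-edge. Each composite
   provides two faces of such a 4-simplex: 0124 and 023, resp. 0134 and 123, resp.
   0234 and 124. In the outer cases an epsilon-horn replaces the triangle by a
   3-simplex containing 04, and the union of the faces 1 and 3 is filled. In the
   middle case the triangles 013 and 123 are first filled to a 3-simplex 0123: an
   additional epsilon-edge rotates this quadrilateral so that its diagonal 13 takes
   the position required by the extension property; the rest is filled by
   epsilon-horns. *)
Require Import Defs.
From mathcomp Require Import all_boot zify.
From Stdlib Require Import FunctionalExtensionality PropExtensionality.
Set Implicit Arguments.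
Unset Strict Implicit.
Unset Printing Implicit Defensive.

(** * Monotone maps given by functions on natural numbers; cofaces and codegeneracies *)

Lemma mono_eq m n (f g : monotone m n) : (forall i, f i = g i :> nat) -> f = g.
Proof. by move=> efg; apply: monoP => i; apply: val_inj; apply: efg. Qed.

Fixpoint running_max (f : nat -> nat) i :=
  if i is i'.+1 then maxn (running_max f i') (f i) else f 0.

Lemma running_max_homo f : {homo running_max f : i j / i <= j}.
Proof.
apply: homo_leq leqnn _ _ => [|i]; first exact: leq_trans.
exact: leq_maxl.
Qed.

Lemma running_maxE f i : (forall j, j <= i -> f j <= f i) -> running_max f i = f i.
Proof.
have le_max g k b : (forall j, j <= k -> g j <= b) -> running_max g k <= b.
  elim: k => [|k IHk] gb /=; first exact: gb.
  by rewrite geq_max gb // IHk // => j ?; apply: gb; apply: leqW.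
move=> f_le; apply/eqP; rewrite eqn_leq le_max //=.
by case: i {f_le} => //= i; apply: leq_maxr.
Qed.

Fact mono_of_subproof m n f :
  let e : {ffun 'I_m.+1 -> 'I_n.+1} :=
    [ffun k : 'I_m.+1 => inord (minn n (running_max f k))] in
  [forall i : 'I_m.+1, forall j : 'I_m.+1, (i <= j) ==> (e i <= e j)].
Proof.
apply/'forall_forallP => i j; apply/implyP => le_ij.
rewrite !ffunE !inordK ?ltnS ?geq_minl //.
by have := running_max_homo f le_ij; lia.
Qed.

(* Taking running maxima and truncating at n makes the map [m] -> [n] total in
   f, so that no monotonicity proof has to be carried around. *)
Definition mono_of m n f : monotone m n := Monotone (mono_of_subproof m n f).

Lemma val_mono_of m n f (i : 'I_m.+1) :
  mono_of m n f i = minn n (running_max f i) :> nat.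
Proof. by rewrite ffunE inordK // ltnS geq_minl. Qed.

Lemma mono_ofE m n f (i : 'I_m.+1) :
  (forall j, j <= i -> f j <= f i) -> f i <= n -> mono_of m n f i = f i :> nat.
Proof. by move=> f_le fn; rewrite val_mono_of running_maxE //; apply/minn_idPr. Qed.

Definition vertices m n (s : seq nat) : monotone m n := mono_of m n (nth 0 s).
Definition coface k j : monotone k k.+1 := mono_of k k.+1 (bump j).
Definition codegeneracy k j : monotone k.+1 k := mono_of k.+1 k (unbump j).

Lemma cofaceE k j i : coface k j i = bump j i :> nat.
Proof.
by rewrite mono_ofE // => [l|]; rewrite /bump; have := ltn_ord i; lia.
Qed.

(** At [i = j = k.+1] the value [unbump j i] is [k.+1], which [codegeneracy] truncates to [k]; hence
    the condition [i != j]. *)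
Lemma codegeneracyE k j (i : 'I_k.+2) :
  j <= k.+1 -> i != j :> nat -> codegeneracy k j i = unbump j i :> nat.
Proof.
move=> jk ij; rewrite mono_ofE // => [l|]; rewrite /unbump; have := ltn_ord i; lia.
Qed.

Lemma edge_mapE n i j (le_ij : i <= j) (le_jn : j <= n) (l : 'I_2) :
  edge_map le_ij le_jn l = nth 0 [:: i; j] l :> nat.
Proof. by rewrite ffunE; case: l => [[|[|]]]. Qed.

Lemma in_faceP n (i : 'I_n.+1) m (x : monotone m n) :
  reflect (forall k, x k != i :> nat) (in_face i x).
Proof. exact: forallP. Qed.

Lemma coface_in_face k (j : 'I_k.+2) : in_face j (coface k j).
Proof. by apply/in_faceP => i; rewrite cofaceE eq_sym neq_bump. Qed.

Lemma codegeneracyK k (j : 'I_k.+2) :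
  mono_comp (codegeneracy k j) (coface k j) = mono_id k.
Proof.
apply: mono_eq => i; rewrite mono_compE mono_idE.
have := cofaceE j i; move: (coface k j i) => c cE.
have jk := ltn_ord j; have := neq_bump j i; rewrite eq_sym -cE => cj.
by rewrite codegeneracyE // cE bumpK.
Qed.

(** * Gluing simplices along a union of faces *)

Section Glue.
Variables (X : eps_sset) (k : nat) (P : pred 'I_k.+2) (S : eps_sub (simplex k.+1)).
Hypothesis S_faces : forall m (x : monotone m k.+1),
  sub_simp S (x : simp (simplex k.+1) m) = [exists (j | P j), in_face j x].
Variable y : 'I_k.+2 -> simp X k.
(** Quantifying over all simplices of the intersection also covers [k = 0], where distinct faces are
    disjoint. *)
Hypothesis y_compat : forall (i j : 'I_k.+2), P i -> P j -> i < j ->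
  forall m (f : monotone m k.+1), in_face i f -> in_face j f ->
  act (mono_comp (codegeneracy k i) f) (y i)
  = act (mono_comp (codegeneracy k j) f) (y j).
(** The marked edge can only lie in faces opposite inner vertices. The premise fails for the horns
    of dimension one, which are single vertices. *)
Hypothesis y_eps : sub_eps S tt -> exists2 j : 'I_k.+2, P j && (0 < j < k.+1) &
  is_eps_edge (act (vertices 1 k [:: 0; k]) (y j)).

(** On face [j], [codegeneracy k j] inverts [coface k j], so [y j] prescribes the image of [x]. By
    [y_compat] the choice of [j] does not matter; [ord0] is a default for [x] outside the union. *)
Definition glued m (x : monotone m k.+1) : simp X m :=
  let j := odflt ord0 [pick j | P j && in_face j x] in
  act (mono_comp (codegeneracy k j) x) (y j).

Lemma gluedE m (x : monotone m k.+1) j : P j -> in_face j x ->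
  glued x = act (mono_comp (codegeneracy k j) x) (y j).
Proof.
move=> Pj xj; rewrite /glued; case: pickP => [i /andP[Pi xi]|/(_ j)] /=; last first.
  by rewrite Pj xj.
have [lt_ij|lt_ji|/val_inj -> //] := ltngtP i j; first exact: y_compat.
by rewrite -(y_compat Pj Pi lt_ji).
Qed.

Lemma glued_act l m (f : monotone l m) (x : monotone m k.+1) :
  sub_simp S (x : simp (simplex k.+1) m) ->
  glued (mono_comp x f) = act f (glued x).
Proof.
rewrite S_faces => /exists_inP[j Pj xj].
by rewrite !(gluedE Pj) ?mono_compA ?act_comp //; apply: (@face_act k.+1).
Qed.

(** The glued values form a morphism out of [S]; by Yoneda, its extension to the whole simplex
    yields [z] as the image of the identity map. *)
Lemma glue : extension_property X (incl S) ->
  exists2 z : simp X k.+1,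
    is_eps_edge (act (edge_map (leq0n k.+1) (leqnn k.+1)) z) &
    forall j, P j -> act (coface k j) z = y j.
Proof.
move=> ext.
have [he heP] : exists he : eps (sub_obj S) -> eps X, forall e,
    glued (edge_map (leq0n k.+1) (leqnn k.+1)) = eps_edge (he e).
  case S_tt: (sub_eps S tt); last first.
    (* If [S] misses the marked edge, its set of marked elements is empty and [he] is the empty
       map. *)
    suff no (e : eps (sub_obj S)) : False by exists (fun e => False_rect _ (no e)).
    by case: e => -[]; rewrite S_tt.
  have [j /andP[Pj j_in] [e eE]] := y_eps S_tt; exists (fun=> e) => _.
  have ne_j (i : 'I_2) : edge_map (leq0n k.+1) (leqnn k.+1) i != j :> nat.
    by rewrite edge_mapE; case: i => [[|[|]]] //= _; lia.
  rewrite (gluedE Pj); last exact/in_faceP.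
  rewrite eE; congr act; apply: mono_eq => i; rewrite mono_compE.
  rewrite (codegeneracyE (leq_ord j) (ne_j i)) edge_mapE val_mono_of.
  by case: i => [[|[|]]] //= _; rewrite /unbump; lia.
pose h := @EpsHom (sub_obj S) X (fun m x => glued (sval x)) he
  (fun m n f x => glued_act f (svalP x)) heP.
have [g [g_simp _]] := ext h.
exists (@hom_simp _ _ g k.+1 (mono_id k.+1)).
  exists (hom_eps g tt); rewrite -hom_eps_edge /= -hom_act /=.
  by rewrite mono_comp1f.
move=> j Pj; rewrite -hom_act /= mono_comp1f.
have Sj : sub_simp S (coface k j : simp (simplex k.+1) k).
  by rewrite S_faces; apply/exists_inP; exists j => //; apply: coface_in_face.
rewrite (g_simp k (exist (fun x : simp (simplex k.+1) k => sub_simp S x) _ Sj)) /=.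
rewrite (gluedE Pj) ?coface_in_face //.
by rewrite codegeneracyK act_id.
Qed.

End Glue.

(** A map avoiding both [i] and [j] factors through the common codimension-two face; [r] is that
    factor, and the two composites are its images under [coface k j.-1] and [coface k i]. *)
Lemma compat_faces (X : eps_sset) k (i j : 'I_k.+3) (yi yj : simp X k.+1) m
    (f : monotone m k.+2) :
  i < j -> act (coface k j.-1) yi = act (coface k i) yj ->
  in_face i f -> in_face j f ->
  act (mono_comp (codegeneracy k.+1 i) f) yi
  = act (mono_comp (codegeneracy k.+1 j) f) yj.
Proof.
move=> lt_ij yij /in_faceP fi /in_faceP fj.
have [ik jk] := (ltn_ord i, ltn_ord j).
pose r := mono_comp (codegeneracy k i) (mono_comp (codegeneracy k.+1 j) f).
have rE l : r l = unbump i (unbump j (f l)) :> nat.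
  rewrite !mono_compE; have [fil fjl] := (fi l, fj l).
  have cE := @codegeneracyE k.+1 j (f l) jk fjl.
  by rewrite codegeneracyE ?cE /unbump; lia.
clearbody r.
have -> : mono_comp (codegeneracy k.+1 i) f = mono_comp (coface k j.-1) r.
  apply: mono_eq => l; rewrite !(mono_compE _ _ l).
  have [fil fjl] := (fi l, fj l).
  rewrite codegeneracyE ?cofaceE ?rE /bump /unbump; lia.
have -> : mono_comp (codegeneracy k.+1 j) f = mono_comp (coface k i) r.
  apply: mono_eq => l; rewrite !(mono_compE _ _ l).
  have [fil fjl] := (fi l, fj l).
  rewrite codegeneracyE ?cofaceE ?rE /bump /unbump; lia.
by rewrite !act_comp yij.
Qed.

Lemma glue_faces (X : eps_sset) k (P : pred 'I_k.+3) (S : eps_sub (simplex k.+2))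
    (y : 'I_k.+3 -> simp X k.+1) :
  (forall m (x : monotone m k.+2),
    sub_simp S (x : simp (simplex k.+2) m) = [exists (j | P j), in_face j x]) ->
  (forall i j : 'I_k.+3, P i -> P j -> i < j ->
    act (coface k j.-1) (y i) = act (coface k i) (y j)) ->
  (exists2 j : 'I_k.+3, P j && (0 < j < k.+2) &
    is_eps_edge (act (vertices 1 k.+1 [:: 0; k.+1]) (y j))) ->
  extension_property X (incl S) ->
  exists2 z : simp X k.+2,
    is_eps_edge (act (edge_map (leq0n k.+2) (leqnn k.+2)) z) &
    forall j, P j -> act (coface k.+1 j) z = y j.
Proof.
move=> S_faces y_compat y_eps; apply: (glue S_faces) => // i j Pi Pj lt_ij m f.
exact/(compat_faces lt_ij)/y_compat.
Qed.

(** * Restriction of simplices along lists of vertices *)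

Notation "x |_( i )" := (act (vertices 0 _ [:: i]) x)
  (at level 8, format "x |_( i )").
Notation "x |_( i , j )" := (act (vertices 1 _ [:: i; j]) x)
  (at level 8, format "x |_( i ,  j )").
Notation "x |_( i , j , k )" := (act (vertices 2 _ [:: i; j; k]) x)
  (at level 8, format "x |_( i ,  j ,  k )").
Notation "x |_( i , j , k , l )" := (act (vertices 3 _ [:: i; j; k; l]) x)
  (at level 8, format "x |_( i ,  j ,  k ,  l )").

Definition vertex_at n s i := minn n (running_max (nth 0 s) i).

(** [vertex_at] evaluates [vertices] on natural numbers, so for concrete lists the hypothesis is
    decided by computation. *)
Lemma act_vertices (X : eps_sset) l m n s t (x : simp X n) :
  all (fun i => vertex_at n s (vertex_at l t i)
                == vertex_at n (map (nth 0 s) t) i) (iota 0 m.+1) ->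
  act (vertices m l t) (act (vertices l n s) x)
  = act (vertices m n (map (nth 0 s) t)) x.
Proof.
move=> /allP eq_st; rewrite -act_comp; congr act; apply: mono_eq => i.
rewrite mono_compE !val_mono_of; apply/eqP/eq_st.
by rewrite mem_iota /= add0n.
Qed.

Lemma coface_vertices k j : coface k j = vertices k k.+1 (map (bump j) (iota 0 k.+1)).
Proof.
apply: mono_eq => i; rewrite cofaceE mono_ofE => [|l le_li|].
- by rewrite (nth_map 0) ?size_iota // nth_iota.
- have [lk ik] : l < k.+1 /\ i < k.+1 by have := ltn_ord i; lia.
  by rewrite !(nth_map 0) ?size_iota // !nth_iota // /bump; lia.
by rewrite (nth_map 0) ?size_iota // nth_iota // /bump; have := ltn_ord i; lia.
Qed.

Lemma edge_map_vertices n i j (le_ij : i <= j) (le_jn : j <= n) :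
  edge_map le_ij le_jn = vertices 1 n [:: i; j].
Proof.
by apply: mono_eq => -[[|[|l]] lt_l2] //; rewrite edge_mapE val_mono_of /=; lia.
Qed.

Lemma act_vertices01 (X : eps_sset) (e : simp X 1) : e|_(0, 1) = e.
Proof.
rewrite -[RHS]act_id; congr act; apply: mono_eq => i.
by rewrite mono_idE val_mono_of; case: i => [[|[|?]] ?].
Qed.

(** * Fillers from epsilon-horns and from two faces of a 4-simplex *)

Section Fill.
Variable X : eps_sset.
Hypothesis X_horn : forall n, 1 <= n ->
  extension_property X (incl (horn (@ord0 n))) /\
  extension_property X (incl (horn (@ord_max n))).
Hypothesis X_ext : extension_property X
  (incl (subU (@face 4 (inord 1)) (@face 4 (inord 3)))).

(** In dimension one the horn at the last vertex is that vertex alone, so extending it gives an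
    epsilon-edge with prescribed target. *)
Lemma eps_edge_into (v : simp X 0) :
  exists2 e : simp X 1, is_eps_edge e & e|_(1) = v.
Proof.
have [_ ext] := X_horn (leqnn 1).
have [|i j Pi Pj|/existsP[j]|e e_eps eP] :=
    glue (P := fun j => j != ord_max) _ (y := fun _ => v) _ _ ext.
- by [].
- by move: i j Pi Pj => [[|[|?]] ?] [[|[|?]] ?].
- case/andP=> j_max /in_faceP/(_ ord0); rewrite edge_mapE.
  by case: j j_max => [[|[|?]] ?].
exists e; first by move: e_eps; rewrite edge_map_vertices act_vertices01.
by rewrite -(eP ord0) // coface_vertices.
Qed.

Lemma fill2_first (a e : simp X 1) : is_eps_edge e -> a|_(0) = e|_(0) ->
  exists s : simp X 2, s|_(0, 1) = a /\ s|_(0, 2) = e.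
Proof.
move=> e_eps ae; have [ext _] := X_horn (isT : 1 <= 2).
(* Entry [j] of the list is the face opposite vertex [j]; entry 0 is a placeholder for the face
   missing from the horn. *)
have [//|i j||s _ sP] :=
    glue_faces (P := fun j => j != ord0) (y := fun j => nth a [:: a; e; a] j) _ _ _ ext.
- by move: i j => [[|[|[|?]]] ?] [[|[|[|?]]] ?];
    rewrite -?val_eqE // !coface_vertices.
- by exists (@Ordinal 3 1 isT) => //=; rewrite act_vertices01.
have := (sP (@Ordinal 3 2 isT) isT, sP (@Ordinal 3 1 isT) isT).
by rewrite !coface_vertices => -[]; exists s.
Qed.

Lemma fill2_last (b e : simp X 1) : is_eps_edge e -> b|_(1) = e|_(1) ->
  exists s : simp X 2, s|_(1, 2) = b /\ s|_(0, 2) = e.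
Proof.
move=> e_eps be; have [_ ext] := X_horn (isT : 1 <= 2).
have [//|i j||s _ sP] :=
    glue_faces (P := fun j => j != ord_max) (y := fun j => nth b [:: b; e; b] j) _ _ _ ext.
- by move: i j => [[|[|[|?]]] ?] [[|[|[|?]]] ?];
    rewrite -?val_eqE // !coface_vertices.
- by exists (@Ordinal 3 1 isT) => //=; rewrite act_vertices01.
have := (sP (@Ordinal 3 0 isT) isT, sP (@Ordinal 3 1 isT) isT).
by rewrite !coface_vertices => -[]; exists s.
Qed.

Lemma fill3_first (A B C : simp X 2) : is_eps_edge B|_(0, 2) ->
  A|_(0, 1) = B|_(0, 1) -> A|_(0, 2) = C|_(0, 1) -> B|_(0, 2) = C|_(0, 2) ->
  exists t : simp X 3, [/\ t|_(0, 1, 2) = A, t|_(0, 1, 3) = B & t|_(0, 2, 3) = C].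
Proof.
move=> B_eps AB AC BC; have [ext _] := X_horn (isT : 1 <= 3).
have [//|i j||t _ tP] :=
    glue_faces (P := fun j => j != ord0) (y := fun j => nth A [:: A; C; B; A] j) _ _ _ ext.
- by move: i j => [[|[|[|[|?]]]] ?] [[|[|[|[|?]]]] ?];
    rewrite -?val_eqE // !coface_vertices.
- by exists (@Ordinal 4 2 isT).
have := (tP (@Ordinal 4 1 isT) isT, tP (@Ordinal 4 2 isT) isT, tP (@Ordinal 4 3 isT) isT).
by rewrite !coface_vertices => -[[]]; exists t.
Qed.

Lemma fill3_last (B C D : simp X 2) : is_eps_edge B|_(0, 2) ->
  B|_(0, 2) = C|_(0, 2) -> B|_(1, 2) = D|_(0, 2) -> C|_(1, 2) = D|_(1, 2) ->
  exists t : simp X 3, [/\ t|_(0, 1, 3) = B, t|_(0, 2, 3) = C & t|_(1, 2, 3) = D].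
Proof.
move=> B_eps BC BD CD; have [_ ext] := X_horn (isT : 1 <= 3).
have [//|i j||t _ tP] :=
    glue_faces (P := fun j => j != ord_max) (y := fun j => nth B [:: D; C; B] j) _ _ _ ext.
- by move: i j => [[|[|[|[|?]]]] ?] [[|[|[|[|?]]]] ?];
    rewrite -?val_eqE // !coface_vertices.
- by exists (@Ordinal 4 2 isT).
have := (tP (@Ordinal 4 0 isT) isT, tP (@Ordinal 4 1 isT) isT, tP (@Ordinal 4 2 isT) isT).
by rewrite !coface_vertices => -[[]]; exists t.
Qed.

Lemma fill4_first (A B C D : simp X 3) : is_eps_edge B|_(0, 3) ->
  A|_(0, 1, 2) = B|_(0, 1, 2) -> A|_(0, 1, 3) = C|_(0, 1, 2) ->
  A|_(0, 2, 3) = D|_(0, 1, 2) -> B|_(0, 1, 3) = C|_(0, 1, 3) ->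
  B|_(0, 2, 3) = D|_(0, 1, 3) -> C|_(0, 2, 3) = D|_(0, 2, 3) ->
  exists z : simp X 4, [/\ z|_(0, 1, 2, 3) = A, z|_(0, 1, 2, 4) = B,
    z|_(0, 1, 3, 4) = C & z|_(0, 2, 3, 4) = D].
Proof.
move=> B_eps AB AC AD BC BD CD; have [ext _] := X_horn (isT : 1 <= 4).
have [//|i j||z _ zP] :=
  glue_faces (P := fun j => j != ord0) (y := fun j => nth A [:: A; D; C; B; A] j)
    _ _ _ ext.
- by move: i j => [[|[|[|[|[|?]]]]] ?] [[|[|[|[|[|?]]]]] ?];
    rewrite -?val_eqE // !coface_vertices.
- by exists (@Ordinal 5 3 isT).
have := (zP (@Ordinal 5 1 isT) isT, zP (@Ordinal 5 2 isT) isT,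
         zP (@Ordinal 5 3 isT) isT, zP (@Ordinal 5 4 isT) isT).
by rewrite !coface_vertices => -[[[]]]; exists z.
Qed.

Lemma fill4_faces13 (B D : simp X 3) : is_eps_edge B|_(0, 3) ->
  B|_(0, 2, 3) = D|_(0, 1, 3) ->
  exists z : simp X 4, [/\ z|_(0, 1, 2, 4) = B, z|_(0, 2, 3, 4) = D
    & is_eps_edge z|_(0, 4)].
Proof.
move=> B_eps BD.
(* [D] is the face opposite 1; the face opposite 3 is the default value [B] of [nth]. *)
have [m x|i j||z z_eps zP] :=
  glue_faces (P := pred2 (inord 1) (inord 3)) (y := fun j => nth B [:: B; D] j)
    _ _ _ X_ext.
- apply/idP/exists_inP => [/orP[x1|x3]|[j /orP[]/eqP-> xj]]; last 2 first.
  - by apply/orP; left.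
  - by apply/orP; right.
  - by exists (inord 1); rewrite //= eqxx.
  - by exists (inord 3); rewrite //= eqxx orbT.
- move=> /orP[]/eqP-> /orP[]/eqP->; rewrite ?inordK //= => _.
  by rewrite !coface_vertices.
- by exists (inord 3); rewrite /= ?inordK ?eqxx ?orbT.
have := zP (inord 1); rewrite /= eqxx coface_vertices inordK //= => /(_ isT) zD.
have := zP (inord 3); rewrite /= eqxx orbT coface_vertices inordK //= => /(_ isT) zB.
by exists z; split=> //; move: z_eps; rewrite edge_map_vertices.
Qed.

(** Since [03] is an epsilon-edge, [fill2_first] produces the triangle [023]; the three triangles at
    vertex 0 then form an epsilon-horn. *)
Lemma fan3_first (A B : simp X 2) : is_eps_edge B|_(0, 2) ->
  A|_(0, 1) = B|_(0, 1) ->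
  exists t : simp X 3, t|_(0, 1, 2) = A /\ t|_(0, 1, 3) = B.
Proof.
move=> B_eps AB.
have [|C [CA CB]] := @fill2_first A|_(0, 2) _ B_eps.
  by have := congr1 (fun e => e|_(0)) AB; rewrite !act_vertices.
have [t [tA tB _]] := fill3_first B_eps AB (esym CA) (esym CB).
by exists t.
Qed.

(** Dually, [fill2_last] produces [013] from [13] and [03], completing the horn at vertex 3. *)
Lemma fan3_last (C D : simp X 2) : is_eps_edge C|_(0, 2) ->
  C|_(1, 2) = D|_(1, 2) ->
  exists t : simp X 3, t|_(0, 2, 3) = C /\ t|_(1, 2, 3) = D.
Proof.
move=> C_eps CD.
have [|B [BD BC]] := @fill2_last D|_(0, 2) _ C_eps.
  by have := congr1 (fun e => e|_(1)) CD; rewrite !act_vertices.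
have B_eps : is_eps_edge B|_(0, 2) by rewrite BC.
have [t [_ tC tD]] := fill3_last B_eps BC BD CD.
by exists t.
Qed.

(** Here the missing triangle of the horn at vertex 3 is [023], obtained from [23] and [03]. *)
Lemma fan3_outer (B D : simp X 2) : is_eps_edge B|_(0, 2) ->
  B|_(1, 2) = D|_(0, 2) ->
  exists t : simp X 3, t|_(0, 1, 3) = B /\ t|_(1, 2, 3) = D.
Proof.
move=> B_eps BD.
have [|C [CD CB]] := @fill2_last D|_(1, 2) _ B_eps.
  by have := congr1 (fun e => e|_(1)) BD; rewrite !act_vertices.
have [t [tB _ tD]] := fill3_last B_eps (esym CB) BD CD.
by exists t.
Qed.

(* Let e be an epsilon-edge from a new vertex * to 3. The triangles extend to
   3-simplices *123 and *013 meeting in *13, which are the faces 1 and 3 of a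
   4-simplex *0123. *)
Lemma fill3_diagonal13 (B D : simp X 2) : B|_(1, 2) = D|_(0, 2) ->
  exists t : simp X 3, t|_(0, 1, 3) = B /\ t|_(1, 2, 3) = D.
Proof.
move=> BD.
have [e e_eps eB] := eps_edge_into B|_(2).
have [|E [ED Ee]] := @fill2_last D|_(0, 2) _ e_eps.
  by rewrite eB -BD act_vertices.
have E_eps : is_eps_edge E|_(0, 2) by rewrite Ee.
have [T [TE TD]] := fan3_outer E_eps ED.
have [|U [UE UB]] := @fan3_last E B E_eps.
  by rewrite ED BD.
have [||z [zU zT _]] := @fill4_faces13 U T.
- by move: E_eps; rewrite -UE act_vertices.
- by rewrite UE.
by exists z|_(1, 2, 3, 4); rewrite -UB -TD -zU -zT !act_vertices.
Qed.

(** * Four-simplices extending the data of each composite *)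

Lemma frobenius_left (t : simp X 3) (s : simp X 2) : is_eps_edge t|_(0, 3) ->
  s|_(0, 1) = t|_(0, 2) ->
  exists z : simp X 4, [/\ z|_(0, 1, 2, 4) = t, z|_(0, 2, 3) = s
    & is_eps_edge z|_(0, 4)].
Proof.
move=> t_eps st.
(* [023] and [024] share the edge [02] and span [0234], as [04] is an epsilon-edge. *)
have [||r [rs rt]] := @fan3_first s t|_(0, 2, 3); rewrite ?act_vertices //.
have [|//|z [zt zr z_eps]] := @fill4_faces13 t r => //.
by exists z; rewrite -rs -zr act_vertices.
Qed.

Lemma frobenius_right (t : simp X 3) (s : simp X 2) : is_eps_edge t|_(0, 3) ->
  s|_(1, 2) = t|_(1, 3) ->
  exists z : simp X 4, [/\ z|_(0, 2, 3, 4) = t, z|_(1, 2, 4) = s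
    & is_eps_edge z|_(0, 4)].
Proof.
move=> t_eps st.
(* [024] and [124] share the edge [24] and span [0124]. *)
have [||r [rt rs]] := @fan3_last t|_(0, 1, 3) s; rewrite ?act_vertices //.
have [||z [zr zt z_eps]] := @fill4_faces13 r t => //.
  by move: t_eps; have := congr1 (fun A => A|_(0, 2)) rt; rewrite !act_vertices // => ->.
by exists z; rewrite -rs -zr act_vertices.
Qed.

Lemma frobenius_middle (t : simp X 3) (s : simp X 2) : is_eps_edge t|_(0, 3) ->
  s|_(0, 2) = t|_(1, 2) ->
  exists z : simp X 4, [/\ z|_(0, 1, 3, 4) = t, z|_(1, 2, 3) = s
    & is_eps_edge z|_(0, 4)].
Proof.
move=> t_eps st.
(* In the 4-simplex to be built, [A] is [0123], [E] is [024], [B] is [0124] and [D] is [0234]; with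
   [t] as [0134] they complete the horn at vertex 0. *)
have [|A [At As]] := @fill3_diagonal13 t|_(0, 1, 2) s; rewrite ?act_vertices //.
have [|E [EA Et]] := @fill2_first A|_(0, 2) _ t_eps.
  by have := congr1 (fun A => A|_(0)) At; rewrite !act_vertices.
have At01 : A|_(0, 1) = t|_(0, 1).
  by have := congr1 (fun A => A|_(0, 1)) At; rewrite !act_vertices.
have At03 : A|_(0, 3) = t|_(0, 2).
  by have := congr1 (fun A => A|_(0, 2)) At; rewrite !act_vertices.
have [||||B [BA Bt BE]] := @fill3_first A|_(0, 1, 2) t|_(0, 1, 3) E;
  rewrite ?act_vertices //.
have [||||D [DA DE Dt]] := @fill3_first A|_(0, 2, 3) E t|_(0, 2, 3);
  rewrite ?act_vertices ?Et //.
have B_eps : is_eps_edge B|_(0, 3).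
  by move: t_eps; have := congr1 (fun A => A|_(0, 2)) Bt; rewrite !act_vertices // => ->.
have [z [zA zB zt _]] := fill4_first B_eps (esym BA) At (esym DA) Bt
  (etrans BE (esym DE)) (esym Dt).
exists z; split=> //; first by rewrite -As -zA act_vertices.
by move: B_eps; rewrite -zB act_vertices.
Qed.

(** * The three composites described by 4-simplices *)

Definition frobenius_filler : relation (simp X 1 * simp X 1) (simp X 1 * simp X 1) :=
  fun ba pq => exists z : simp X 4,
    [/\ is_eps_edge z|_(0, 4), (z|_(2, 3), z|_(1, 2)) = ba
      & (z|_(0, 3), z|_(1, 4)) = pq].

Lemma delta_mu_filler ba pq :
  (delta X \circ mu X) ba pq <-> frobenius_filler ba pq.
Proof.
case: ba pq => b a [p q]; split.
  case=> c [[s [sa sb sc]] [t [tp tq tc t_eps]]]; move: t_eps sa sb sc tp tq tc.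
  rewrite /edge !edge_map_vertices /= => t_eps <- <- <- <- <- ts.
  have [z [<- <- z_eps]] := frobenius_middle t_eps (esym ts).
  by exists z; rewrite !act_vertices.
(* The composite passes through the diagonal [13], shared by [123] and [0134]. *)
case=> z [z_eps [<- <-] [<- <-]]; exists z|_(1, 3); split.
  by exists z|_(1, 2, 3); rewrite /edge !edge_map_vertices !act_vertices.
by exists z|_(0, 1, 3, 4); rewrite /edge !edge_map_vertices !act_vertices.
Qed.

Lemma mu_delta_filler ba pq :
  (mu X \times rel_id \circ rel_assoc \circ (rel_id \times delta X)) ba pq
  <-> frobenius_filler ba pq.
Proof.
case: ba pq => b a [p q]; split.
  case=> -[b' [u q']] [[/= <- [t [tu tq ta t_eps]]] [_ [-> [/= [s [su sb sp]] <-]]]].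
  move: t_eps tu tq ta su sb sp.
  rewrite /edge !edge_map_vertices /= => t_eps <- <- <- st <- <-.
  have [z [<- <- z_eps]] := frobenius_left t_eps st.
  by exists z; rewrite !act_vertices.
(* The face [0124] splits [12] into [02] and [14]; the face [023] multiplies [02] and [23] to
   [03]. *)
case=> z [z_eps [<- <-] [<- <-]]; exists (z|_(2, 3), (z|_(0, 2), z|_(1, 4))); split.
  split=> //=; exists z|_(0, 1, 2, 4).
  by rewrite /edge !edge_map_vertices !act_vertices.
exists (z|_(2, 3), z|_(0, 2), z|_(1, 4)); split=> //; split=> //=.
by exists z|_(0, 2, 3); rewrite /edge !edge_map_vertices !act_vertices.
Qed.

Lemma delta_id_mu_filler ba pq :
  (rel_id \times mu X \circ rel_assocV \circ (delta X \times rel_id)) ba pq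
  <-> frobenius_filler ba pq.
Proof.
case: ba pq => b a [p q]; split.
  case=> -[[p' v] a'] [[/= [t [tp tv tb t_eps]] <-] [_ [-> [/= <- [s [sa sv sq]]]]]].
  move: t_eps tp tv tb sa sv sq.
  rewrite /edge !edge_map_vertices /= => t_eps <- <- <- <- st <-.
  have [z [<- <- z_eps]] := frobenius_right t_eps st.
  by exists z; rewrite !act_vertices.
(* The face [0234] splits [23] into [03] and [24]; the face [124] multiplies [12] and [24] to
   [14]. *)
case=> z [z_eps [<- <-] [<- <-]]; exists (z|_(0, 3), z|_(2, 4), z|_(1, 2)); split.
  split=> //=; exists z|_(0, 2, 3, 4).
  by rewrite /edge !edge_map_vertices !act_vertices.
exists (z|_(0, 3), (z|_(2, 4), z|_(1, 2))); split=> //; split=> //=.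
by exists z|_(1, 2, 4); rewrite /edge !edge_map_vertices !act_vertices.
Qed.

End Fill.

Lemma relation_ext A B (R S : relation A B) : (forall a b, R a b <-> S a b) -> R = S.
Proof.
move=> RS; apply: functional_extensionality => a.
by apply: functional_extensionality => b; apply: propositional_extensionality.
Qed.

Theorem theorem7p1 (X : eps_sset)
  (X_horn : forall n : nat, 1 <= n ->
     extension_property X (incl (horn (@ord0 n))) /\
     extension_property X (incl (horn (@ord_max n))))
  (X_ext : extension_property X
     (incl (subU (@face 4 (inord 1)) (@face 4 (inord 3))))) :
  (mu X \times rel_id) \circ rel_assoc \circ (rel_id \times delta X)
    = delta X \circ mu X /\
  delta X \circ mu X
    = (rel_id \times mu X) \circ rel_assocV \circ (delta X \times rel_id).
Proof.
split; apply: relation_ext => ba pq.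
  exact: iff_trans (mu_delta_filler X_horn X_ext _ _)
    (iff_sym (delta_mu_filler X_horn X_ext _ _)).
exact: iff_trans (delta_mu_filler X_horn X_ext _ _)
  (iff_sym (delta_id_mu_filler X_horn X_ext _ _)).
Qed.
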